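(* Let $0<l_2\le l_1$ be real numbers, and put $$c^*=\tfrac12\left(l_1+l_2+\sqrt{l_1^2+l_2^2-l_1l_2}\right),\qquad b^*=\frac{c^*}{2c^*/l_2-1}.$$ For any real $x>b^*$ there exists a unique triangle $ABC$ with $l_a=l_2$, $l_b=l_1$ and side $b=CA=x$. If $x\le b^*$, no such triangle exists.
   Context: For a non-degenerate triangle $ABC$ in the Euclidean plane, $a=BC$, $b=CA$, $c=AB$ are its side lengths; $l_a$ and $l_b$ denote the lengths of the internal angle bisectors drawn from $A$ and $B$ respectively, measured from the vertex to the opposite side. Uniqueness of triangles is understood up to congruence respecting the vertex labels. *)

(* Defs.v *)
From Stdlib Require Import Reals.
Open Scope R_scope.

Definition point : Type := (R * R)%type.

Definition dist (P Q : point) : R := dist_euc (fst P) (snd P) (fst Q) (snd Q).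

Definition nondegenerate (A B C : point) : Prop :=
  (fst B - fst A) * (snd C - snd A) - (snd B - snd A) * (fst C - fst A) <> 0.

(* The unoriented angle PVQ at the vertex V, in [0, PI]; it is meaningful only
   when P and Q are both different from V. *)
Definition angle (P V Q : point) : R :=
  acos (((fst P - fst V) * (fst Q - fst V) + (snd P - snd V) * (snd Q - snd V))
        / (dist V P * dist V Q)).

Definition on_segment (D P Q : point) : Prop :=
  exists t : R, 0 <= t <= 1 /\
    D = (fst P + t * (fst Q - fst P), snd P + t * (snd Q - snd P)).

(* [l] is the length of the internal bisector of the angle at [V] in the triangle
   [V P Q], measured from [V] to its foot on the opposite side.  The foot [D]
   exists and is unique when the triangle is non-degenerate. *)
Definition is_bisector_length (V P Q : point) (l : R) : Prop :=
  exists D : point,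
    on_segment D P Q /\ angle P V D = angle D V Q /\ dist V D = l.

Definition isometry (f : point -> point) : Prop :=
  forall P Q : point, dist (f P) (f Q) = dist P Q.

(* Orientation-reversing isometries are allowed. *)
Definition congruent (A B C A' B' C' : point) : Prop :=
  exists f : point -> point, isometry f /\ f A = A' /\ f B = B' /\ f C = C'.

Definition triangle_with (la lb b : R) (A B C : point) : Prop :=
  nondegenerate A B C /\
  is_bisector_length A B C la /\
  is_bisector_length B C A lb /\
  dist C A = b.

(* Main.v *)
(** By the bisector formulas [la^2 = b c (1 - (a/(b+c))^2)] and
    [lb^2 = a c (1 - (b/(a+c))^2)], fixing [b] and [la] makes [a] an increasing
    function of [c]; then [lb] strictly increases with [c], which gives uniqueness.
    The triangle inequality says that [la] is less than the harmonic mean of [b]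
    and [c], i.e. [c > c0 := la b / (2 b - la)].  As [c] runs from [c0] to infinity,
    [lb] runs from its value on a degenerate triangle to infinity, so a solution
    exists exactly when that initial value is less than the prescribed [lb].
    For [b = bstar] one has [c0 = cstar] and the two are equal; the initial value
    decreases with [b]. *)

From Stdlib Require Import Reals Ranalysis5 Lra.
From Coquelicot Require Import Rcomplements.
Require Import Defs.
Open Scope R_scope.

(** * Distances and dot products in the plane *)

Definition dot (V P Q : point) : R :=
  (fst P - fst V) * (fst Q - fst V) + (snd P - snd V) * (snd Q - snd V).

Lemma dist_nonneg P Q : 0 <= dist P Q.
Proof. apply sqrt_pos. Qed.

Lemma dist_sqr P Q :
  dist P Q ^ 2 = (fst P - fst Q) ^ 2 + (snd P - snd Q) ^ 2.
Proof.
unfold dist, dist_euc. rewrite pow2_sqrt; [unfold Rsqr; ring|].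
apply Rplus_le_le_0_compat; apply Rle_0_sqr.
Qed.

Lemma dist_sym P Q : dist P Q = dist Q P.
Proof. apply distance_symm. Qed.

Lemma sqr_inj_nonneg x y : 0 <= x -> 0 <= y -> x ^ 2 = y ^ 2 -> x = y.
Proof. intros hx hy h. apply Rsqr_inj; auto. unfold Rsqr. lra. Qed.

(** The second square is that of the determinant in [nondegenerate], so this yields Cauchy-Schwarz,
    strictly for non-degenerate triangles. *)
Lemma lagrange_identity V P Q :
  dot V P Q ^ 2
    + ((fst P - fst V) * (snd Q - snd V) - (snd P - snd V) * (fst Q - fst V)) ^ 2
  = (dist V P * dist V Q) ^ 2.
Proof. rewrite Rpow_mult_distr, !dist_sqr. unfold dot. ring. Qed.

Lemma cauchy_schwarz V P Q :
  - (dist V P * dist V Q) <= dot V P Q <= dist V P * dist V Q.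
Proof.
pose proof (lagrange_identity V P Q) as H.
pose proof (Rmult_le_pos _ _ (dist_nonneg V P) (dist_nonneg V Q)).
match type of H with _ + ?c ^ 2 = _ => pose proof (pow2_ge_0 c) end.
split; nra.
Qed.

Lemma cauchy_schwarz_strict V P Q : nondegenerate V P Q ->
  - (dist V P * dist V Q) < dot V P Q < dist V P * dist V Q.
Proof.
intros hn.
pose proof (lagrange_identity V P Q) as H.
pose proof (Rmult_le_pos _ _ (dist_nonneg V P) (dist_nonneg V Q)).
unfold nondegenerate in hn. apply pow2_gt_0 in hn.
split; nra.
Qed.

Lemma cosine_law V P Q :
  dist P Q ^ 2 = dist V P ^ 2 + dist V Q ^ 2 - 2 * dot V P Q.
Proof. rewrite !dist_sqr. unfold dot. ring. Qed.

Lemma dist_pos P Q : P <> Q -> 0 < dist P Q.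
Proof.
intros h. destruct (dist_nonneg P Q) as [|e]; auto. exfalso; apply h.
pose proof (dist_sqr P Q) as H. rewrite <- e in H.
destruct P as [p1 p2], Q as [q1 q2]; simpl fst in H; simpl snd in H.
destruct (Rplus_sqr_eq_0 (p1 - q1) (p2 - q2)); [unfold Rsqr; lra|].
f_equal; lra.
Qed.

Lemma nondegenerate_rotate A B C : nondegenerate A B C -> nondegenerate B C A.
Proof. unfold nondegenerate. intros h e. apply h. lra. Qed.

Lemma nondegenerate_dist_pos A B C : nondegenerate A B C -> 0 < dist A B.
Proof. intros h. apply dist_pos. intros e. apply h. rewrite e. ring. Qed.

Lemma nondegenerate_sides A B C : nondegenerate A B C ->
  0 < dist A B /\ 0 < dist B C /\ 0 < dist C A.
Proof.
intros h. pose proof (nondegenerate_rotate _ _ _ h) as h1.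
pose proof (nondegenerate_rotate _ _ _ h1) as h2.
repeat split; eapply nondegenerate_dist_pos; eassumption.
Qed.

Lemma triangle_inequality_strict V P Q : nondegenerate V P Q ->
  dist P Q < dist V P + dist V Q /\ (dist V P - dist V Q) ^ 2 < dist P Q ^ 2.
Proof.
intros h. pose proof (cauchy_schwarz_strict V P Q h).
pose proof (cosine_law V P Q).
pose proof (dist_nonneg V P). pose proof (dist_nonneg V Q).
pose proof (dist_nonneg P Q). split; nra.
Qed.

(** * Angles and the bisector length formula *)

Lemma acos_inj x y : -1 <= x <= 1 -> -1 <= y <= 1 -> acos x = acos y -> x = y.
Proof. intros hx hy e. rewrite <- (cos_acos x hx), <- (cos_acos y hy), e. auto. Qed.

Lemma cos_angle_range V P Q : 0 < dist V P -> 0 < dist V Q ->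
  -1 <= dot V P Q / (dist V P * dist V Q) <= 1.
Proof.
intros hp hq. pose proof (cauchy_schwarz V P Q).
pose proof (Rmult_lt_0_compat _ _ hp hq).
split; [apply -> Rle_div_r|apply <- Rle_div_l]; lra.
Qed.

Lemma angle_eq_iff V P D Q : 0 < dist V P -> 0 < dist V D -> 0 < dist V Q ->
  (angle P V D = angle D V Q <-> dot V P D * dist V Q = dot V D Q * dist V P).
Proof.
intros hp hd hq. unfold angle. fold (dot V P D) (dot V D Q).
transitivity (dot V P D / (dist V P * dist V D) = dot V D Q / (dist V D * dist V Q)).
- split; [|intros ->; auto]. apply acos_inj; apply cos_angle_range; auto.
- split; intros e.
  + apply (Rmult_eq_compat_r (dist V P * dist V D * dist V Q)) in e.
    field_simplify in e; [|lra..]. lra.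
  + apply (Rmult_eq_reg_r (dist V P * dist V D * dist V Q)).
    * field_simplify; [|lra..].
      replace (dot V P D * dist V Q) with (dot V D Q * dist V P). ring.
    * apply Rgt_not_eq. repeat apply Rmult_lt_0_compat; auto.
Qed.

(** Squared bisector length at a vertex with adjacent sides [u], [v] and opposite side [w]. *)
Definition bisector_sqr (u v w : R) : R := u * v * (1 - (w / (u + v)) ^ 2).

Definition segment_point (P Q : point) (t : R) : point :=
  (fst P + t * (fst Q - fst P), snd P + t * (snd Q - snd P)).

Lemma dist_segment_point V P Q t :
  dist V (segment_point P Q t) ^ 2
  = (1 - t) ^ 2 * dist V P ^ 2 + 2 * (t * (1 - t)) * dot V P Q + t ^ 2 * dist V Q ^ 2.
Proof. rewrite !dist_sqr. unfold dot, segment_point. simpl. ring. Qed.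

Lemma dist_segment_point_pos V P Q t : nondegenerate V P Q ->
  0 < dist V (segment_point P Q t).
Proof.
intros h. apply dist_pos. intros e. apply h. unfold segment_point in e.
rewrite e. simpl. ring.
Qed.

Lemma angle_segment_point V P Q t : nondegenerate V P Q ->
  (angle P V (segment_point P Q t) = angle (segment_point P Q t) V Q
   <-> t = dist V P / (dist V P + dist V Q)).
Proof.
intros h. destruct (nondegenerate_sides _ _ _ h) as (hp & _ & hq).
rewrite dist_sym in hq.
pose proof (cauchy_schwarz_strict V P Q h) as hcs.
pose proof (dist_segment_point_pos V P Q t h) as hd.
rewrite angle_eq_iff; auto.
assert (e1 : dot V P (segment_point P Q t) = (1 - t) * dist V P ^ 2 + t * dot V P Q).
{ rewrite dist_sqr. unfold dot, segment_point. simpl. ring. }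
assert (e2 : dot V (segment_point P Q t) Q = (1 - t) * dot V P Q + t * dist V Q ^ 2).
{ rewrite dist_sqr. unfold dot, segment_point. simpl. ring. }
rewrite e1, e2. clear e1 e2.
set (u := dist V P) in *. set (v := dist V Q) in *. set (d := dot V P Q) in *.
split; intros e.
(* The first factor is positive by strict Cauchy-Schwarz; the second gives the division of the
   opposite side in the ratio [u : v]. *)
- assert (e' : (u * v - d) * ((1 - t) * u - t * v) = 0) by nra.
  apply Rmult_integral in e'. destruct e' as [e'|e']; [lra|].
  field_simplify_eq; lra.
- rewrite e. field. lra.
Qed.

Lemma is_bisector_length_iff V P Q l : nondegenerate V P Q -> 0 < l ->
  (is_bisector_length V P Q l
   <-> l ^ 2 = bisector_sqr (dist V P) (dist V Q) (dist P Q)).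
Proof.
intros h hl. destruct (nondegenerate_sides _ _ _ h) as (hp & _ & hq).
rewrite dist_sym in hq.
pose proof (cosine_law V P Q) as hcos.
assert (key : dist V (segment_point P Q (dist V P / (dist V P + dist V Q))) ^ 2
              = bisector_sqr (dist V P) (dist V Q) (dist P Q)).
{ rewrite dist_segment_point. transitivity (dist V P * dist V Q * (1 - dist P Q ^ 2 / (dist V P + dist V Q) ^ 2)).
  - rewrite hcos. field. lra.
  - unfold bisector_sqr. field. lra. }
split.
- intros (D & (t & ht & ->) & e & <-).
  apply angle_segment_point in e; auto. subst t. exact key.
- intros e. set (t := dist V P / (dist V P + dist V Q)) in *.
  exists (segment_point P Q t). repeat split.
  + exists t. repeat split; unfold t; [apply -> Rle_div_r|apply <- Rle_div_l]; lra.
  + apply angle_segment_point; auto.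
  + apply sqr_inj_nonneg; [apply dist_nonneg|lra|lra].
Qed.

Lemma triangle_with_iff la lb b A B C : 0 < la -> 0 < lb ->
  (triangle_with la lb b A B C <->
   nondegenerate A B C /\
   la ^ 2 = bisector_sqr (dist A B) (dist C A) (dist B C) /\
   lb ^ 2 = bisector_sqr (dist B C) (dist A B) (dist C A) /\
   dist C A = b).
Proof.
intros ha hb. unfold triangle_with.
assert (iff_and : nondegenerate A B C ->
  (is_bisector_length A B C la
   <-> la ^ 2 = bisector_sqr (dist A B) (dist C A) (dist B C)) /\
  (is_bisector_length B C A lb
   <-> lb ^ 2 = bisector_sqr (dist B C) (dist A B) (dist C A))).
{ intros h. rewrite (dist_sym C A) at 1. rewrite (dist_sym A B) at 2.
  auto using is_bisector_length_iff, nondegenerate_rotate. }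
tauto.
Qed.

(** * Triangles and their side lengths *)

(* The congruence is the affine map sending one triangle to the other; it is an
   isometry because the Gram matrices of the edge vectors agree. *)
Lemma congruent_of_sides A B C A' B' C' : nondegenerate A B C ->
  dist A B = dist A' B' -> dist B C = dist B' C' -> dist C A = dist C' A' ->
  congruent A B C A' B' C'.
Proof.
intros h hc ha hb.
pose proof (cosine_law A B C) as hd. pose proof (cosine_law A' B' C') as hd'.
rewrite (dist_sym A C), hc, ha, hb in hd. rewrite (dist_sym A' C') in hd'.
assert (e3 : dot A B C = dot A' B' C') by lra. clear hd hd'.
apply (f_equal (fun x => x ^ 2)) in hc. apply (f_equal (fun x => x ^ 2)) in hb.
rewrite !dist_sqr in hc, hb. clear ha. unfold nondegenerate, dot in *.
destruct A as [a1 a2], B as [b1 b2], C as [c1 c2], A' as [a1' a2'],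
  B' as [b1' b2'], C' as [c1' c2']. cbn [fst snd] in *.
set (d := (b1 - a1) * (c2 - a2) - (b2 - a2) * (c1 - a1)) in *.
(* By Cramer's rule, [s P] and [t P] are the coordinates of [P] in the affine frame with origin [A]
   and edge vectors [AB], [AC]. *)
set (s := fun P : point => ((fst P - a1) * (c2 - a2) - (snd P - a2) * (c1 - a1)) / d).
set (t := fun P : point => ((b1 - a1) * (snd P - a2) - (b2 - a2) * (fst P - a1)) / d).
exists (fun P => (a1' + s P * (b1' - a1') + t P * (c1' - a1'),
                  a2' + s P * (b2' - a2') + t P * (c2' - a2'))).
split; [|unfold s, t; cbn [fst snd]; repeat split; f_equal; fold d].
- intros P Q. apply sqr_inj_nonneg; [apply dist_nonneg..|].
  rewrite !dist_sqr. cbn [fst snd].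
  transitivity ((s P - s Q) ^ 2 * ((a1' - b1') ^ 2 + (a2' - b2') ^ 2)
    + 2 * ((s P - s Q) * (t P - t Q))
      * ((b1' - a1') * (c1' - a1') + (b2' - a2') * (c2' - a2'))
    + (t P - t Q) ^ 2 * ((c1' - a1') ^ 2 + (c2' - a2') ^ 2)); [ring|].
  rewrite <- e3, <- hc, <- hb. unfold s, t, d. field. exact h.
- field; exact h.
- field; exact h.
- unfold d; field; exact h.
- unfold d; field; exact h.
- unfold d; field; exact h.
- unfold d; field; exact h.
Qed.

Lemma exists_triangle_of_sides a b c : 0 < a -> 0 < b -> 0 < c ->
  a < b + c -> (b - c) ^ 2 < a ^ 2 ->
  exists A B C : point,
    nondegenerate A B C /\ dist A B = c /\ dist B C = a /\ dist C A = b.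
Proof.
intros ha hb hc h1 h2.
(* With [A] at the origin and [C = (b, 0)], the law of cosines makes [x] the abscissa of [B]; the
   triangle inequalities amount to [|x| < c]. *)
set (x := (b ^ 2 + c ^ 2 - a ^ 2) / (2 * b)).
assert (ex : 2 * b * x = b ^ 2 + c ^ 2 - a ^ 2) by (unfold x; field; lra).
assert (hx : x ^ 2 < c ^ 2).
{ assert (- c < x < c) by (split; nra). nra. }
set (y := sqrt (c ^ 2 - x ^ 2)).
assert (hy : 0 < y) by (apply sqrt_lt_R0; lra).
assert (ey : y ^ 2 = c ^ 2 - x ^ 2) by (apply pow2_sqrt; lra).
exists (0, 0), (x, y), (b, 0). unfold nondegenerate; simpl. split; [nra|].
repeat split; apply sqr_inj_nonneg; try apply dist_nonneg; try lra;
  rewrite dist_sqr; simpl; nra.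
Qed.

(** * Monotonicity of the bisector formula and the side it determines *)

Lemma bisector_sqr_mono u v w u' v' w' : 0 < u -> 0 < v ->
  0 <= w' <= w -> w < u + v -> u <= u' -> v < v' ->
  bisector_sqr u v w < bisector_sqr u' v' w'.
Proof.
intros hu hv hw hw' h1 h2. unfold bisector_sqr.
assert (0 <= w' / (u' + v') <= w / (u + v)).
{ split; [apply -> Rle_div_r; lra|].
  apply Rmult_le_compat; [lra| |lra|apply Rinv_le_contravar; lra].
  apply Rlt_le, Rinv_0_lt_compat; lra. }
assert (w / (u + v) < 1) by (apply <- Rlt_div_l; lra).
assert (u * v < u' * v') by nra.
apply Rlt_le_trans with (u' * v' * (1 - (w / (u + v)) ^ 2)).
- apply Rmult_lt_compat_r; nra.
- apply Rmult_le_compat_l; nra.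
Qed.

(** In a flat triangle the bisector becomes the harmonic mean of its adjacent sides, here [c - b]
    and [c]. *)
Lemma bisector_sqr_degenerate b c : 0 < b < c ->
  bisector_sqr (c - b) c b = (2 * c * (c - b) / (2 * c - b)) ^ 2.
Proof. intros h. unfold bisector_sqr. field. lra. Qed.

(** The solution [a] of [l ^ 2 = bisector_sqr c b a], meaningful when [l ^ 2 <= b * c]; otherwise
    [sqrt] of a negative number makes it 0. *)
Definition side_of_bisector (l b c : R) : R :=
  (b + c) * sqrt (1 - l ^ 2 / (b * c)).

Lemma side_of_bisector_nonneg l b c : 0 < b -> 0 < c ->
  0 <= side_of_bisector l b c.
Proof. intros hb hc. apply Rmult_le_pos; [lra|apply sqrt_pos]. Qed.

Lemma side_of_bisector_unique l a b c : 0 <= a -> 0 < b -> 0 < c ->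
  l ^ 2 = bisector_sqr c b a -> a = side_of_bisector l b c.
Proof.
intros ha hb hc e. unfold side_of_bisector. rewrite e. unfold bisector_sqr.
replace (1 - _) with ((a / (c + b)) ^ 2) by (field; lra).
rewrite sqrt_pow2; [field; lra|]. apply -> Rle_div_r; lra.
Qed.

Lemma bisector_sqr_side l b c : 0 < b -> 0 < c -> l ^ 2 <= b * c ->
  l ^ 2 = bisector_sqr c b (side_of_bisector l b c).
Proof.
intros hb hc h. unfold bisector_sqr, side_of_bisector.
replace (_ / (c + b)) with (sqrt (1 - l ^ 2 / (b * c))) by (field; lra).
rewrite pow2_sqrt; [field; lra|].
assert (l ^ 2 / (b * c) <= 1) by (apply <- Rle_div_l; nra). lra.
Qed.

(** Both factors increase with [c]; [sqrt] is monotone on all reals, being 0 on negative ones. *)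
Lemma side_of_bisector_mono l b c c' : 0 < b -> 0 < c <= c' ->
  side_of_bisector l b c <= side_of_bisector l b c'.
Proof.
intros hb hc. apply Rmult_le_compat; [lra|apply sqrt_pos|lra|].
apply sqrt_le_1_alt. apply Rplus_le_compat_l, Ropp_le_contravar.
apply Rmult_le_compat_l; [apply pow2_ge_0|]. apply Rinv_le_contravar; nra.
Qed.

(** Ties the triangle inequality [|b - c| < a] to the comparison of [l] with the harmonic mean of
    [b] and [c]; flatness corresponds to equality. *)
Lemma bisector_triangle_defect l a b c : 0 < b -> 0 < c ->
  l ^ 2 = bisector_sqr c b a ->
  (a ^ 2 - (b - c) ^ 2) * (b * c) = (2 * (b * c)) ^ 2 - (l * (b + c)) ^ 2.
Proof.
intros hb hc e. rewrite (Rpow_mult_distr l), e. unfold bisector_sqr. field. lra.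
Qed.

Lemma bisector_triangle_inequality l a b c : 0 < l -> 0 < b -> 0 < c ->
  l ^ 2 = bisector_sqr c b a ->
  ((b - c) ^ 2 < a ^ 2 <-> l * (b + c) < 2 * (b * c)).
Proof.
intros hl hb hc e. apply bisector_triangle_defect in e; auto.
assert (0 < b * c) by nra. assert (0 < l * (b + c)) by nra.
split; intros h; nra.
Qed.

(** The harmonic mean is at most the geometric mean. This keeps the radicand of [side_of_bisector]
    nonnegative. *)
Lemma sqr_le_of_le_harmonic_mean l b c : 0 < l -> 0 < b -> 0 < c ->
  l * (b + c) <= 2 * (b * c) -> l ^ 2 <= b * c.
Proof.
intros hl hb hc h. assert (0 < b * c) by nra.
assert ((l * (b + c)) ^ 2 <= (2 * (b * c)) ^ 2).
{ apply pow_incr; split; [nra|lra]. }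
assert (l ^ 2 * (4 * (b * c)) <= l ^ 2 * (b + c) ^ 2).
{ apply Rmult_le_compat_l; [apply pow2_ge_0|]. pose proof (pow2_ge_0 (b - c)). nra. }
apply (Rmult_le_reg_r (4 * (b * c))); nra.
Qed.

Lemma side_of_bisector_lt_sum l b c : 0 < l -> 0 < b -> 0 < c ->
  l ^ 2 <= b * c -> side_of_bisector l b c < b + c.
Proof.
intros hl hb hc h. unfold side_of_bisector.
rewrite <- (Rmult_1_r (b + c)) at 2. apply Rmult_lt_compat_l; [lra|].
rewrite <- sqrt_1 at 2. apply sqrt_lt_1_alt.
assert (l ^ 2 / (b * c) <= 1) by (apply <- Rle_div_l; nra).
assert (0 < l ^ 2 / (b * c)) by (apply Rdiv_lt_0_compat; nra).
lra.
Qed.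

Lemma second_bisector_continuous l b c : 0 < b -> 0 < c -> l ^ 2 <= b * c ->
  continuity_pt (fun c => bisector_sqr (side_of_bisector l b c) c b) c.
Proof.
intros hb hc h.
pose proof (side_of_bisector_nonneg l b c hb hc).
assert (l ^ 2 / (b * c) <= 1) by (apply <- Rle_div_l; nra).
unfold bisector_sqr, side_of_bisector in *. reg.
- lra.
- nra.
- lra.
Qed.

(** * Uniqueness *)

Lemma triangle_with_unique la lb b A B C A' B' C' : 0 < la -> 0 < lb ->
  triangle_with la lb b A B C -> triangle_with la lb b A' B' C' ->
  congruent A B C A' B' C'.
Proof.
intros hla hlb h h'.
apply triangle_with_iff in h; auto. apply triangle_with_iff in h'; auto.
destruct h as (hn & ha & hb & hx), h' as (hn' & ha' & hb' & hx').
destruct (nondegenerate_sides _ _ _ hn) as (pc & pa & pb).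
destruct (nondegenerate_sides _ _ _ hn') as (pc' & pa' & pb').
destruct (triangle_inequality_strict B C A) as [ti _].
{ apply nondegenerate_rotate, hn. }
destruct (triangle_inequality_strict B' C' A') as [ti' _].
{ apply nondegenerate_rotate, hn'. }
rewrite (dist_sym B A) in ti. rewrite (dist_sym B' A') in ti'.
apply side_of_bisector_unique in ha; [|lra..].
apply side_of_bisector_unique in ha'; [|lra..].
rewrite hx in *. rewrite hx' in *.
assert (ec : dist A B = dist A' B').
(* A longer side [c] would force [a] to be at least as long, hence a strictly longer bisector from
   [B]. *)
{ destruct (Rtotal_order (dist A B) (dist A' B')) as [lt|[eq|lt]]; auto; exfalso.
  - pose proof (side_of_bisector_mono la b (dist A B) (dist A' B')).
    assert (bisector_sqr (dist B C) (dist A B) b < bisector_sqr (dist B' C') (dist A' B') b);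
      [apply bisector_sqr_mono|]; lra.
  - pose proof (side_of_bisector_mono la b (dist A' B') (dist A B)).
    assert (bisector_sqr (dist B' C') (dist A' B') b < bisector_sqr (dist B C) (dist A B) b);
      [apply bisector_sqr_mono|]; lra. }
apply congruent_of_sides; auto; [congruence|lra].
Qed.

(** * The critical triangle, non-existence and existence *)

(* [cs] and [bs] are two sides of the degenerate triangle with [a = cs - bs] in
   which both bisectors, now harmonic means of the adjacent sides, have the
   prescribed lengths. *)
Lemma critical_sides l1 l2 : 0 < l1 -> 0 < l2 ->
  let cs := 1 / 2 * (l1 + l2 + sqrt (l1 ^ 2 + l2 ^ 2 - l1 * l2)) in
  let bs := cs / (2 * cs / l2 - 1) in
  0 < bs < l2 /\ l2 < cs /\ bs * (2 * cs - l2) = l2 * cs /\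
  bisector_sqr (cs - bs) cs bs = l1 ^ 2.
Proof.
intros h1 h2 cs bs.
assert (hs : sqrt (l1 ^ 2 + l2 ^ 2 - l1 * l2) ^ 2 = l1 ^ 2 + l2 ^ 2 - l1 * l2).
{ apply pow2_sqrt. nra. }
assert (hcs : l2 < cs).
{ pose proof (sqrt_pos (l1 ^ 2 + l2 ^ 2 - l1 * l2)). unfold cs. nra. }
(* [cs] is the larger root of the quadratic obtained by eliminating [bs] from the two harmonic mean
   conditions. *)
assert (ec : 4 * cs ^ 2 = 4 * (l1 + l2) * cs - 3 * l1 * l2).
{ unfold cs. nra. }
clearbody cs.
assert (eb : bs = l2 * cs / (2 * cs - l2)) by (unfold bs; field; lra).
assert (eb' : bs * (2 * cs - l2) = l2 * cs) by (rewrite eb; field; lra).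
clearbody bs.
assert (hbs : 0 < bs < l2).
{ split; [rewrite eb; apply Rdiv_lt_0_compat; nra|nra]. }
repeat split; try tauto.
rewrite bisector_sqr_degenerate by lra. f_equal.
apply (Rmult_eq_reg_r (2 * cs - bs)); [|lra]. field_simplify; [|lra].
rewrite eb. field_simplify_eq; [|lra]. nra.
Qed.

(** Here [l2] is the harmonic mean of [bs] and [cs]. If [x <= bs], the triangle inequality forces
    [c > cs], so [a > c - x > cs - bs], and the bisector from [B] exceeds [l1]. *)
Lemma triangle_with_side_gt l1 l2 bs cs A B C x : 0 < l1 -> 0 < l2 ->
  0 < bs < l2 -> l2 < cs -> bs * (2 * cs - l2) = l2 * cs ->
  bisector_sqr (cs - bs) cs bs = l1 ^ 2 ->
  triangle_with l2 l1 x A B C -> bs < x.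
Proof.
intros h1 h2 hb hc e el h.
destruct (Rlt_le_dec bs x) as [|hx]; auto. exfalso.
apply triangle_with_iff in h; auto. destruct h as (hn & ha & hl & ex).
destruct (nondegenerate_sides _ _ _ hn) as (pc & pa & pb).
destruct (triangle_inequality_strict A B C) as [_ ti]; auto.
rewrite (dist_sym A C), ex in ti. rewrite ex in *. clear ex.
set (a := dist B C) in *. set (c := dist A B) in *.
pose proof (bisector_triangle_inequality l2 a x c h2 pb pc ha) as [ti' _].
assert (hc' : l2 * (x + c) < 2 * (x * c)) by (apply ti'; lra).
assert (cs < c).
{ destruct (Rlt_le_dec cs c) as [|hcc]; auto. exfalso.
  assert (0 < 2 * x - l2) by nra. nra. }
assert (c - x < a) by nra.
assert (bisector_sqr (cs - bs) cs bs < bisector_sqr a c x); [|lra].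
apply bisector_sqr_mono; lra.
Qed.

Lemma exists_triangle_with l1 l2 bs cs x : 0 < l1 -> 0 < l2 ->
  0 < bs < l2 -> l2 < cs -> bs * (2 * cs - l2) = l2 * cs ->
  bisector_sqr (cs - bs) cs bs = l1 ^ 2 -> bs < x ->
  exists A B C, triangle_with l2 l1 x A B C.
Proof.
intros h1 h2 hb hc e el hx.
assert (hx2 : 0 < 2 * x - l2) by nra.
(* The flat case: [l2] is the harmonic mean of [x] and [c0]. *)
set (c0 := l2 * x / (2 * x - l2)).
assert (e0 : c0 * (2 * x - l2) = l2 * x) by (unfold c0; field; lra).
assert (p0 : 0 < c0) by (apply Rdiv_lt_0_compat; nra).
clearbody c0.
assert (hc0 : c0 < cs).
{ apply (Rmult_lt_reg_r (2 * x - l2)); nra. }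
assert (hge : forall c, c0 <= c -> l2 * (x + c) <= 2 * (x * c)) by (intros; nra).
assert (hgt : forall c, c0 < c -> l2 * (x + c) < 2 * (x * c)) by (intros; nra).
(* Large enough that [a > x + 2 * l1] and [c1 > 2 * x + 2 * l1], which pushes the bisector from [B]
   beyond [l1]. *)
set (c1 := c0 + 2 * x + 2 * l1).
assert (ha : forall c, c0 <= c -> l2 ^ 2 = bisector_sqr c x (side_of_bisector l2 x c)).
{ intros c h. apply bisector_sqr_side; [lra..|]. apply sqr_le_of_le_harmonic_mean; [lra..|auto]. }
assert (lo : bisector_sqr (side_of_bisector l2 x c0) c0 x < l1 ^ 2).
{ pose proof (side_of_bisector_nonneg l2 x c0 ltac:(lra) p0) as pa.
  assert (ea : side_of_bisector l2 x c0 ^ 2 = (x - c0) ^ 2).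
  { pose proof (bisector_triangle_defect l2 _ x c0 ltac:(lra) p0 (ha c0 (Rle_refl _))) as d.
    replace (l2 * (x + c0)) with (2 * (x * c0)) in d by lra.
    rewrite Rminus_diag in d. apply Rmult_integral in d. destruct d; [lra|nra]. }
  (* At [c0] one has [a = |x - c0|]. If [c0 <= x], then [a + c0 = x] and the bisector from [B]
     vanishes; otherwise [c0 < cs] and [bs < x] allow comparison with the critical triangle. *)
  destruct (Rle_lt_dec c0 x) as [hle|hlt].
  - rewrite (sqr_inj_nonneg _ (x - c0) pa ltac:(lra) ea).
    unfold bisector_sqr. replace (x / _) with 1 by (field; lra). nra.
  - rewrite (sqr_inj_nonneg _ (c0 - x) pa ltac:(lra)) by lra.
    rewrite <- el. apply bisector_sqr_mono; lra. }
assert (hi : l1 ^ 2 < bisector_sqr (side_of_bisector l2 x c1) c1 x).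
{ assert (0 < c1 /\ c0 < c1) as [p1 q1] by (unfold c1; lra).
  pose proof (side_of_bisector_nonneg l2 x c1 ltac:(lra) p1) as pa.
  pose proof (bisector_triangle_inequality l2 _ x c1 h2 ltac:(lra) p1 (ha c1 (Rlt_le _ _ q1)))
    as [_ ti].
  specialize (ti (hgt c1 q1)).
  assert (c1 - x < side_of_bisector l2 x c1) by nra.
  apply Rlt_trans with (bisector_sqr (x + 2 * l1) (2 * x + 2 * l1) x);
    [|apply bisector_sqr_mono; unfold c1 in *; lra].
  unfold bisector_sqr.
  assert (0 <= x / (x + 2 * l1 + (2 * x + 2 * l1)) <= 1 / 3).
  { split; [apply -> Rle_div_r|apply <- Rle_div_l]; lra. }
  apply Rlt_le_trans with ((x + 2 * l1) * (2 * x + 2 * l1) * (1 / 2)); [nra|].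
  apply Rmult_le_compat_l; nra. }
destruct (IVT_interv
  (fun c => bisector_sqr (side_of_bisector l2 x c) c x - l1 ^ 2) c0 c1)
  as (c & hcc & ez); [|unfold c1; lra|lra|lra|].
{ intros c h. apply continuity_pt_minus; [|apply continuity_pt_const; now intros ? ?].
  apply second_bisector_continuous; [lra..|]. apply sqr_le_of_le_harmonic_mean; [lra..|].
  apply hge; lra. }
(* The value at [c0] is strictly too small, so the root avoids the flat triangle. *)
assert (hlt : c0 < c).
{ destruct (proj1 hcc) as [|eq]; auto. rewrite <- eq in ez. lra. }
set (a := side_of_bisector l2 x c) in *.
specialize (ha c (proj1 hcc)). fold a in ha.
assert (pc : 0 < c) by lra.
assert (ti : (x - c) ^ 2 < a ^ 2).
{ apply (bisector_triangle_inequality l2 a x c); auto; lra. }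
assert (0 <= a) by (apply side_of_bisector_nonneg; lra).
destruct (exists_triangle_of_sides a x c) as (A & B & C & hn & ec & ea & eb); try lra.
{ pose proof (pow2_ge_0 (x - c)). nra. }
{ apply side_of_bisector_lt_sum; [lra..|].
  apply sqr_le_of_le_harmonic_mean; [lra..|]. apply hge; lra. }
exists A, B, C. apply triangle_with_iff; auto. rewrite ea, eb, ec. intuition lra.
Qed.

Theorem mainTheorem5 (l1 l2 : R) (hl2 : 0 < l2) (hl : l2 <= l1) :
  let cstar := 1 / 2 * (l1 + l2 + sqrt (l1 ^ 2 + l2 ^ 2 - l1 * l2)) in
  let bstar := cstar / (2 * cstar / l2 - 1) in
  (forall x : R, bstar < x ->
     exists A B C : point,
       triangle_with l2 l1 x A B C /\
       forall A' B' C' : point,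
         triangle_with l2 l1 x A' B' C' -> congruent A B C A' B' C') /\
  (forall x : R, x <= bstar ->
     ~ exists A B C : point, triangle_with l2 l1 x A B C).
Proof.
intros cstar bstar.
assert (hl1 : 0 < l1) by lra.
destruct (critical_sides l1 l2 hl1 hl2) as (hb & hc & e & el).
fold cstar in hb, hc, e, el. fold bstar in hb, e, el.
split.
- intros x hx.
  destruct (exists_triangle_with l1 l2 bstar cstar x) as (A & B & C & h); auto.
  exists A, B, C. eauto using triangle_with_unique.
- intros x hx (A & B & C & h). apply (Rle_not_lt _ _ hx).
  apply (triangle_with_side_gt l1 l2 bstar cstar A B C x); auto.
Qed.
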